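(* Let $(G,H)$ be a correlated graph system with planted matching $\sigma^*$, true intersection graph $I$ and true union graph $U$, and set $\rho=SOV(U)$. Then, for any $\varepsilon>0$, there exists an estimator $\hat\sigma$ of $\sigma^*$ such that $$ov(\hat\sigma,\sigma^* )\ \geq\ \frac{|V_{\geq(\rho+\varepsilon)}|}{n}\,(1-o_{\mathbb P}(1)),$$ where $V_{\geq(\rho+\varepsilon)}=\{v\in V: w_I(v)\geq\rho+\varepsilon\}$.
   Context: **Graphs.** $n$ is an integer tending to infinity, $V=[n]$, $E=\{\{u,v\}:u\neq v\in V\}$, $\mathcal S_n$ is the group of permutations of $[n]$. A graph over $V$ is identified with its edge set. For $\sigma\in\mathcal S_n$, $\sigma(\{u,v\})=\{\sigma(u),\sigma(v)\}$ and $\sigma(K)=\{\sigma(e):e\in K\}$; $K\land_\sigma K'=\sigma(K)\cap K'$, $K\lor_\sigma K'=\sigma(K)\cup K'$. $\operatorname{Fix}\sigma=\{v\in V:\sigma(v)=v\}$, $\operatorname{Der}\sigma=V\setminus\operatorname{Fix}\sigma$. The overlap is $ov(\sigma,\sigma')=\frac1n\#\{v\in[n]:\sigma(v)=\sigma'(v)\}$. **Balanced load.** Let $\vec E(K)$ be the set of directed edges $(u\to v)$ with $\{u,v\}\in K$. An allocation on $K$ is a map $\theta:\vec E(K)\to[0,1]$ with $\theta(u\to v)+\theta(v\to u)=1$ for all $(u\to v)\in\vec E(K)$; its load is $\partial\theta(v)=\sum_{u:\{u,v\}\in K}\theta(u\to v)$. It is balanced if for every edge $\{u,v\}$, $\partial\theta(u)<\partial\theta(v)$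 implies $\theta(u\to v)=0$. Balanced allocations exist and all have the same load function, denoted $w_K:V\to\mathbb R_+$ (the balanced load function of $K$). **Probabilistic notation.** For real random variables, $\operatorname{plimsup}_{n\to+\infty}X_n=\sup\{x\in\mathbb R:\limsup_n\mathbb P(X_n\geq x)>0\}$. $X_n=o_{\mathbb P}(Y_n)$ means $X_n=c_nY_n$ with $c_n\to0$ in probability. **Self-overlap.** For a sequence of random graphs $K=K_n$ over $V=[n]$, $$SOV(K)=\lim_{\varepsilon\to0}\operatorname*{plimsup}_{n\to+\infty}\max_{\sigma\in\mathcal S_n}\ \max_{\mathcal A\subseteq\operatorname{Der}\sigma,\ |\mathcal A|\geq\varepsilon n}\ \min_{v\in\mathcal A}w_{(K\land_\sigma K)}(v)\in[0,+\infty].$$ **Correlated graph system.** Let $(K_1,K_2)$ be a pair of random graphs over $V$ with some arbitrary joint law (depending on $n$), and $\sigma^*\in\mathcal S_n$ uniformly random and independent of $(K_1,K_2)$. The correlated graph system is $(G,H)=((\sigma^* )^{-1}(K_1),K_2)$. Set $I=G\land_{\sigma^*}H$ and $U=G\lor_{\sigma^*}H$. An estimator of $\sigma^*$ is an $\mathcal S_n$-valued function of the observation $(G,H)$.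
   Formalization: The o_P(1) factor is only required to vanish in probability on the events |V_{≥(ρ+ε)}| ≥ δn, for each fixed δ>0 (i.e. ov ≥ |V_{≥(ρ+ε)}|/n − o_P(1)); as printed the claim fails, e.g. for K_1=K_2 a fixed triangle plus isolated vertices with ε=1. *)

(* Defs.v *)
(* MathComp / MathComp-Analysis. *)
From HB Require Import structures.
From mathcomp Require Import all_boot all_order all_algebra all_fingroup.
From mathcomp Require Import all_classical all_reals all_analysis.
Set Implicit Arguments.
Unset Strict Implicit.
Unset Printing Implicit Defensive.
Import Order.TTheory GRing.Theory Num.Theory.
Import numFieldNormedType.Exports.
Local Open Scope classical_set_scope.
Local Open Scope ring_scope.

(* A graph over [n] is its edge set; [edge_set] is the type of all families of
   subsets of [n], and [is_graph] says that every member is a pair {u, v} with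
   u <> v.  [is_graph] is preserved by all the operations below. *)
Definition edge_set (n : nat) := {set {set 'I_n}}.

Definition is_graph (n : nat) (K : edge_set n) : bool :=
  K \subset [set e : {set 'I_n} | #|e| == 2]%SET.

Definition perm_graph (n : nat) (s : 'S_n) (K : edge_set n) : edge_set n :=
  [set s @: (e : {set 'I_n}) | e in K]%SET.

Definition graph_meet (n : nat) (s : 'S_n) (K K' : edge_set n) : edge_set n :=
  (perm_graph s K :&: K')%SET.

Definition graph_join (n : nat) (s : 'S_n) (K K' : edge_set n) : edge_set n :=
  (perm_graph s K :|: K')%SET.

Definition Fix (n : nat) (s : 'S_n) : {set 'I_n} := [set v | s v == v]%SET.

Definition Der (n : nat) (s : 'S_n) : {set 'I_n} := (~: Fix s)%SET.

Definition overlap (R : realType) (n : nat) (s s' : 'S_n) : R :=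
  #|[set v | s v == s' v]%SET|%:R / n%:R.

(* The entry [theta u v] is the mass put on the directed edge u -> v; entries
   at pairs which are not edges of K are irrelevant. *)
Definition allocation (R : realType) (n : nat) (K : edge_set n)
    (theta : 'M[R]_n) : Prop :=
  forall u v : 'I_n, [set u; v]%SET \in K ->
    0 <= theta u v <= 1 /\ theta u v + theta v u = 1.

Definition load (R : realType) (n : nat) (K : edge_set n) (theta : 'M[R]_n)
    (v : 'I_n) : R :=
  \sum_(u : 'I_n | [set u; v]%SET \in K) theta u v.

Definition balanced (R : realType) (n : nat) (K : edge_set n)
    (theta : 'M[R]_n) : Prop :=
  allocation K theta /\
  forall u v : 'I_n, [set u; v]%SET \in K ->
    load K theta u < load K theta v -> theta u v = 0.

(* The load of a chosen balanced allocation: such allocations exist on every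
   graph and all of them have the same load, so the choice is immaterial. *)
Definition balanced_load (R : realType) (n : nat) (K : edge_set n)
    (v : 'I_n) : R :=
  load K (xget 0 [set theta : 'M[R]_n | balanced K theta]) v.

(* max over sigma, and over A included in Der sigma with |A| >= eps n, of
   min_(v in A) w_(K /\_sigma K)(v).  The value 0 of an empty maximum is the
   least element of [0, +oo]; as soon as n >= 2 and eps <= 1, some A is
   admissible.  The value +oo of an empty minimum only occurs when
   eps n <= 0. *)
Definition self_overlap_level (R : realType) (n : nat) (eps : R)
    (K : edge_set n) : \bar R :=
  \big[Order.max/0%E]_(s : 'S_n)
   \big[Order.max/0%E]_(A : {set 'I_n} |
      (A \subset Der s) && (eps * n%:R <= #|A|%:R))
    \big[Order.min/+oo%E]_(v in A) (balanced_load R (graph_meet s K K) v)%:E.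

(* In all that follows, the n-th probability space is (T n, P n). *)

Definition plimsup (R : realType) (d : nat -> measure_display)
    (T : forall n : nat, measurableType (d n))
    (P : forall n : nat, probability (T n) R)
    (X : forall n : nat, T n -> \bar R) : \bar R :=
  ereal_sup (EFin @` [set x : R |
    (0 < limn_esup (fun n => P n [set w | (x%:E <= X n w)%E]))%E]).

Definition SOV (R : realType) (d : nat -> measure_display)
    (T : forall n : nat, measurableType (d n))
    (P : forall n : nat, probability (T n) R)
    (K : forall n : nat, T n -> edge_set n) : \bar R :=
  lim ((fun eps : R =>
    plimsup P (fun n w => self_overlap_level eps (K n w))) @ 0^'+).

(* X_n = o_P(1). *)
Definition littleoP1 (R : realType) (d : nat -> measure_display)
    (T : forall n : nat, measurableType (d n))
    (P : forall n : nat, probability (T n) R)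
    (X : forall n : nat, T n -> R) : Prop :=
  forall eta : R, 0 < eta ->
    (fun n => P n [set w | eta <= `|X n w|]) @ \oo --> 0%E.

(* Random elements of a finite set carrying its discrete sigma-algebra. *)
Definition random_element (d : measure_display) (T : measurableType d)
    (X : Type) (f : T -> X) : Prop :=
  forall B : set X, measurable (f @^-1` B).

Definition independent_elements (R : realType) (d : measure_display)
    (T : measurableType d) (P : probability T R) (X Y : Type)
    (f : T -> X) (g : T -> Y) : Prop :=
  forall (A : set X) (B : set Y),
    P (f @^-1` A `&` g @^-1` B) = (P (f @^-1` A) * P (g @^-1` B))%E.

(* (K1, K2) is a pair of random graphs over [n] with arbitrary joint law, and
   sstar is a uniform permutation independent of that pair. *)
Definition correlated_graph_system (R : realType) (n : nat)
    (d : measure_display) (T : measurableType d) (P : probability T R)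
    (K1 K2 : T -> edge_set n) (sstar : T -> 'S_n) : Prop :=
  [/\ random_element K1 /\ random_element K2,
      (forall w, is_graph (K1 w) /\ is_graph (K2 w)),
      random_element sstar,
      (forall s : 'S_n, P [set w | sstar w = s] = ((n`!)%:R^-1)%:E) &
      independent_elements P (fun w => (K1 w, K2 w)) sstar].

(* The observation (G, H) = (sstar^-1(K1), K2). *)
Definition obsG (n : nat) (T : Type) (K1 : T -> edge_set n)
    (sstar : T -> 'S_n) (w : T) : edge_set n :=
  perm_graph (sstar w)^-1%g (K1 w).

Definition obsH (n : nat) (T : Type) (K2 : T -> edge_set n) (w : T) :
    edge_set n := K2 w.

Definition true_intersection (n : nat) (T : Type) (K1 K2 : T -> edge_set n)
    (sstar : T -> 'S_n) (w : T) : edge_set n :=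
  graph_meet (sstar w) (obsG K1 sstar w) (obsH K2 w).

Definition true_union (n : nat) (T : Type) (K1 K2 : T -> edge_set n)
    (sstar : T -> 'S_n) (w : T) : edge_set n :=
  graph_join (sstar w) (obsG K1 sstar w) (obsH K2 w).

Definition V_ge (R : realType) (n : nat) (I : edge_set n) (t : \bar R) :
    {set 'I_n} :=
  [set v | (t <= (balanced_load R I v)%:E)%E]%SET.

Definition V_frac (R : realType) (n : nat) (I : edge_set n) (t : \bar R) : R :=
  #|V_ge I t|%:R / n%:R.

(* "X_n >= Y_n (1 - o_P(1))" for X_n >= 0 and Y_n in [0, 1], such as the
   fraction of vertices in a random subset of [n].  The error factor c_n is
   required to be o_P(1) on the events {Y_n >= delta}, for each fixed
   delta > 0; in particular c_n is o_P(1) whenever P(Y_n >= delta) --> 1 for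
   some delta > 0.  Where Y_n vanishes in the limit, c_n is not controlled.
   Equivalently, X_n >= Y_n - o_P(1). *)
Definition asymp_ge (R : realType) (d : nat -> measure_display)
    (T : forall n : nat, measurableType (d n))
    (P : forall n : nat, probability (T n) R)
    (X Y : forall n : nat, T n -> R) : Prop :=
  exists c : forall n : nat, T n -> R,
    [/\ (forall n, measurable_fun setT (c n)),
        (forall n w, Y n w * (1 - c n w) <= X n w) &
        forall delta : R, 0 < delta ->
          littleoP1 P (fun n w => if delta <= Y n w then c n w else 0)].

(* Main.v *)
(* Let sigmahat maximise over s the number of vertices of balanced load at
   least rho + eps in G /\_s H, so that this number is at least #V_{>=rho+eps}.
   With tau := s o sstar^-1, s(G) is contained in tau(U) and H in U, so that
   G /\_s H is a subgraph of U /\_tau U, and the balanced load is monotone in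
   the graph; hence, by definition of rho = SOV(U), all but o(n) of the
   vertices counted for s are fixed by tau, uniformly in s.  As #Fix(tau) is
   n ov(s, sstar), the overlap of sigmahat is at least
   #V_{>=rho+eps} / n - o_P(1). *)
Require Import Defs.
From mathcomp Require Import all_boot all_order all_algebra all_fingroup.
From mathcomp Require Import all_classical all_reals all_analysis.
From mathcomp Require Import ring lra.
Import Order.TTheory GRing.Theory Num.Theory.
Import numFieldNormedType.Exports.
Set Implicit Arguments.
Unset Strict Implicit.
Local Open Scope classical_set_scope.
Local Open Scope ring_scope.

(** * Existence of balanced allocations by energy minimisation *)

Definition energy (R : realType) (n : nat) (K : edge_set n)
    (theta : 'M[R]_n) : R := \sum_v load K theta v ^+ 2.

(* Matrices are encoded as row vectors to use the compactness of boxes in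
   'rV[R]_m. *)
Lemma compact_allocation (R : realType) (n : nat) (K : edge_set n) :
  compact [set x : 'rV[R]_(n * n) |
    (forall i, 0 <= x ord0 i <= 1) /\ allocation K (vec_mx x)].
Proof.
(* The bound is put on every entry because [allocation] leaves the entries off the edges free, which
   would break compactness. *)
have -> : [set x : 'rV[R]_(n * n) |
    (forall i, 0 <= x ord0 i <= 1) /\ allocation K (vec_mx x)] =
  [set x : 'rV[R]_(n * n) | forall i, `[0, 1]%classic (x ord0 i)] `&`
  \bigcap_(e in [set e : 'I_n * 'I_n | [set e.1; e.2]%SET \in K])
    ((fun x : 'rV[R]_(n * n) => x ord0 (mxvec_index e.1 e.2) +
       x ord0 (mxvec_index e.2 e.1)) @^-1` [set 1]).
  apply/seteqP; split=> x /=.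
    move=> [x01 Kx]; split=> [i|[u v] /= uvK]; first by rewrite in_itv /= x01.
    by have [_] := Kx _ _ uvK; rewrite !mxE.
  move=> [x01 Kx]; have {}x01 i : 0 <= x ord0 i <= 1.
    by have := x01 i; rewrite in_itv.
  split=> // u v uvK; rewrite !mxE; split=> //.
  exact: (Kx (u, v)).
apply: compact_closedI.
  apply: (@rV_compact R _ (fun=> `[0, 1]%classic)) => i.
  exact: segment_compact.
apply: closed_bigI => -[u v] _.
apply: (@preimage_closed _ R) => [x _|]; last exact: closed_eq.
have coordc i : {for x, continuous (fun y : 'rV[R]_(n * n) => y ord0 i)}.
  exact: coord_continuous.
apply: continuousD; exact: coordc.
Qed.

Lemma continuous_sumr (T : topologicalType) (R : realType) (I : Type)
    (r : seq I) (Q : pred I) (F : I -> T -> R) :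
  (forall i, continuous (F i)) ->
  continuous (fun x => \sum_(i <- r | Q i) F i x).
Proof.
by move=> Fc; apply: continuous_big => // -[a b]; exact: add_continuous.
Qed.

Lemma continuous_energy (R : realType) (n : nat) (K : edge_set n) :
  continuous (fun x : 'rV[R]_(n * n) => energy K (vec_mx x)).
Proof.
apply: continuous_sumr => v.
have lc : continuous (fun y : 'rV[R]_(n * n) => load K (vec_mx y) v).
  apply: continuous_sumr => u.
  have -> : (fun y : 'rV[R]_(n * n) => vec_mx y u v) =
      (fun y => y ord0 (mxvec_index u v)) by apply/funext => y; rewrite mxE.
  exact: coord_continuous.
by move=> x; apply: (continuousM (lc x) (lc x)).
Qed.

Definition move_mass (R : realType) (n : nat) (theta : 'M[R]_n) (u v : 'I_n)
    (t : R) : 'M[R]_n :=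
  theta + t *: delta_mx v u - t *: delta_mx u v.

Lemma load_move_mass (R : realType) (n : nat) (K : edge_set n)
    (theta : 'M[R]_n) (u v : 'I_n) (t : R) (w : 'I_n) :
  [set u; v]%SET \in K ->
  load K (move_mass theta u v t) w =
    load K theta w + t * ((w == u)%:R - (w == v)%:R).
Proof.
(* A unit mass on a -> b loads only its head [b]. *)
move=> uvK; have loadd (a b : 'I_n) : [set a; b]%SET \in K ->
    load K (delta_mx a b : 'M[R]_n) w = (w == b)%:R.
  move=> abK; rewrite /load; have [->|wb] := eqVneq w b.
    rewrite (bigD1 a) //= mxE !eqxx /= big1 ?addr0 // => x /andP[_ /negbTE xa].
    by rewrite mxE xa.
  by rewrite big1 // => x _; rewrite mxE (negbTE wb) andbF.
have entryE x : move_mass theta u v t x w = theta x w +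
    t * (delta_mx v u : 'M[R]_n) x w - t * (delta_mx u v : 'M[R]_n) x w.
  by rewrite !mxE.
have := loadd _ _ uvK; have := loadd v u; rewrite finset.setUC => /(_ uvK).
rewrite /load => <- <-; under eq_bigr do rewrite entryE.
rewrite big_split big_split /= sumrN -!mulr_sumr; ring.
Qed.

(* A minimiser of the sum of the squared loads is balanced: if L(u) < L(v) and
   theta(u -> v) > 0, moving mass t from u -> v to v -> u changes the sum by
   2 t (t - (L(v) - L(u))), which is negative for small t > 0. *)
Lemma exists_balanced (R : realType) (n : nat) (K : edge_set n) :
  exists theta : 'M[R]_n, balanced K theta.
Proof.
pose A := [set x : 'rV[R]_(n * n) |
    (forall i, 0 <= x ord0 i <= 1) /\ allocation K (vec_mx x)].
have A0 : A !=set0.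
  exists (const_mx 2^-1); split=> [i|u v _]; rewrite !mxE; lra.
have [x] := @compact_EVT_min _ _ _ _ A0 (@compact_allocation R n K)
  (continuous_subspaceT (@continuous_energy R n K)).
rewrite inE => -[x01 Kx] xmin.
exists (vec_mx x); split=> // u v uvK luv.
set theta := vec_mx x in Kx luv xmin *.
have [tuv tvu] := Kx _ _ uvK.
apply/eqP/negPn/negP => t0.
have tpos : 0 < theta u v by case/andP: tuv => h _; rewrite lt_def t0.
pose L := load K theta; pose gap := L v - L u.
have gap0 : 0 < gap by rewrite subr_gt0.
(* The cap [theta u v] keeps the new matrix an allocation; the cap [gap / 2] makes t - gap
   negative. *)
pose t := Num.min (theta u v) (gap / 2).
have t_gt0 : 0 < t by rewrite lt_min tpos divr_gt0.
have t_le : t <= theta u v by rewrite ge_min lexx.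
have t_gap : t <= gap / 2 by rewrite ge_min lexx orbT.
have uv : u != v by apply: contraTneq luv => ->; rewrite ltxx.
have vu := uv; rewrite eq_sym in vu.
pose theta' := move_mass theta u v t.
have th01 a b : 0 <= theta a b <= 1 by rewrite mxE.
have theta'E a b : theta' a b = theta a b + t * ((a == v) && (b == u))%:R
   - t * ((a == u) && (b == v))%:R by rewrite !mxE.
have symm : theta v u = 1 - theta u v by lra.
have th'01 a b : 0 <= theta' a b <= 1.
  rewrite theta'E; have := th01 a b; have := th01 u v.
  have [-> | av] := eqVneq a v.
    rewrite (negbTE vu) /=.
    have [-> | bu] := eqVneq b u; last by move=> /=; lra.
    by rewrite symm /=; lra.
  have [-> | au] := eqVneq a u; last by move=> /=; lra.
  by have [-> | bv] := eqVneq b v => /=; lra.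
have A' : mxvec theta' \in A.
  rewrite inE; split.
    by move=> i; case/mxvec_indexP: i => a b; rewrite mxvecE.
  move=> a b abK; rewrite mxvecK; split=> //; have [_ <-] := Kx _ _ abK.
  by rewrite !theta'E ![(b == _) && _]andbC; ring.
have := xmin _ A'; rewrite mxvecK leNgt => /negP; apply.
rewrite /energy.
under eq_bigr do rewrite (load_move_mass _ _ _ uvK).
rewrite (bigD1 u) //= (bigD1 v) //=.
rewrite [ltRHS](bigD1 u) //= [in ltRHS](bigD1 v) //=.
rewrite !eqxx (negbTE uv) (negbTE vu).
rewrite (eq_bigr (fun i => load K theta i ^+ 2)); last first.
  by move=> i /andP[/negbTE -> /negbTE ->]; rewrite subrr mulr0 addr0.
rewrite !addrA ltrD2r /= -/(L u) -/(L v) -subr_lt0.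
have -> : (L u + t * (1 - 0)) ^+ 2 + (L v + t * (0 - 1)) ^+ 2
    - (L u ^+ 2 + L v ^+ 2) = 2 * (t * (t - gap)) by rewrite /gap; ring.
by rewrite pmulr_rlt0 // pmulr_rlt0 // subr_lt0; lra.
Qed.

(** * Monotonicity of the balanced load in the graph *)

(* Sum the loads over S, the set of vertices where the claim fails: the edges
   inside S contribute #E_K(S) <= #E_K'(S), and an edge u -> v entering S
   satisfies theta(u -> v) <= theta'(u -> v), because either
   L(u) < L(v), and theta(u -> v) = 0, or L'(u) >= L(u) >= L(v) > L'(v), and
   theta'(v -> u) = 0. *)
Lemma load_mono (R : realType) (n : nat) (K K' : edge_set n)
    (theta theta' : 'M[R]_n) (v0 : 'I_n) :
  K \subset K' -> balanced K theta -> balanced K' theta' ->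
  load K theta v0 <= load K' theta' v0.
Proof.
move=> KK' [aK bK] [aK' bK'].
pose f u v : R := (if [set u; v]%SET \in K then theta u v else 0)
  - (if [set u; v]%SET \in K' then theta' u v else 0).
have loadB v : load K theta v - load K' theta' v = \sum_u f u v.
  by rewrite /load big_mkcond [X in _ - X]big_mkcond /= -sumrB.
rewrite leNgt; apply/negP => v0S.
pose S := [pred v | load K' theta' v < load K theta v].
have : 0 < \sum_(v | S v) \sum_u f u v.
  rewrite (bigD1 v0) //= ltr_wpDr -?loadB ?subr_gt0 //.
  by apply: sumr_ge0 => v /andP[Sv _]; rewrite -loadB subr_ge0 ltW.
apply/negP; rewrite -leNgt.
under eq_bigr do rewrite (bigID S) /=.
rewrite big_split /=.
suff [inner outer] : \sum_(v | S v) \sum_(u | S u) f u v <= 0 /\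
    \sum_(v | S v) \sum_(u | ~~ S u) f u v <= 0.
  by rewrite /= in inner outer; lra.
split.
  (* Adding the transposed sum pairs the two orientations: each pair then contributes the edge
     indicator of [K] minus that of [K'], which is at most 0. *)
  suff : \sum_(v | S v) \sum_(u | S u) (f u v + f v u) <= 0.
    under eq_bigr do rewrite big_split /=.
    by rewrite big_split /= [X in _ + X]exchange_big /=; lra.
  apply: sumr_le0 => v _; apply: sumr_le0 => u _.
  rewrite /f [[set v; u]%SET]finset.setUC.
  case: ifPn => [uvK|_].
    have uvK' := fintype.subsetP KK' _ uvK; rewrite uvK'.
    by have [_] := aK _ _ uvK; have [_] := aK' _ _ uvK'; lra.
  by case: ifPn => [uvK'|_]; [have [_] := aK' _ _ uvK'|]; lra.
apply: sumr_le0 => v Sv; apply: sumr_le0 => u Su; rewrite /f.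
case: ifPn => [uvK|_]; last first.
  by case: ifPn => [uvK'|_]; [have [/andP[]] := aK' _ _ uvK'|]; lra.
have uvK' := fintype.subsetP KK' _ uvK; rewrite uvK'.
have [/andP[t0 t1] _] := aK _ _ uvK; have [/andP[t0' t1'] t'] := aK' _ _ uvK'.
have [luv|lvu] := ltP (load K theta u) (load K theta v).
  by rewrite (bK _ _ uvK luv); lra.
have vuK' : [set v; u]%SET \in K' by rewrite finset.setUC.
have := bK' _ _ vuK'; rewrite /S /= in Sv Su; rewrite -leNgt in Su.
by move=> /(_ (lt_le_trans Sv (le_trans lvu Su))) => vu0; lra.
Qed.

Lemma balanced_load_mono (R : realType) (n : nat) (K K' : edge_set n)
    (v : 'I_n) :
  K \subset K' -> balanced_load R K v <= balanced_load R K' v.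
Proof.
move=> KK'; apply: load_mono => //.
  exact: (xgetPex 0 (@exists_balanced R n K)).
exact: (xgetPex 0 (@exists_balanced R n K')).
Qed.

(** * From misaligned vertices to self-overlap *)

(** Permutation products apply the left factor first, so the product here is tau = s o sstar^-1. It
    sends sstar(G), a part of the union graph, onto s(G). *)
Lemma graph_meet_sub_union (n : nat) (s sstar : 'S_n) (G H : edge_set n) :
  graph_meet s G H \subset
  graph_meet (sstar^-1 * s)%g (graph_join sstar G H) (graph_join sstar G H).
Proof.
rewrite /graph_meet; apply: finset.setISS; last exact: finset.subsetUr.
apply/fintype.subsetP => e /imsetP[g gG ->].
apply/imsetP; exists (sstar @: g)%SET.
  by rewrite inE; apply/orP; left; apply: imset_f.
rewrite -imset_comp; apply: eq_imset => x /=.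
by rewrite permM permK.
Qed.

(** [sstar] maps the agreement set bijectively onto the fixed points of tau. *)
Lemma card_Fix_overlap (n : nat) (s sstar : 'S_n) :
  #|Fix (sstar^-1 * s)%g| = #|[set v | s v == sstar v]%SET|.
Proof.
rewrite -[RHS](card_imset _ (@perm_inj _ sstar)); congr #|pred_of_set _|.
apply/setP => v; rewrite inE permM; apply/idP/imsetP => [sv|[u + ->]].
  by exists (sstar^-1 v)%g; rewrite ?inE permKV.
by rewrite inE permK.
Qed.

Lemma self_overlap_level_ge (R : realType) (n : nat) (e : R) (K : edge_set n)
    (s : 'S_n) (A : {set 'I_n}) (t : \bar R) :
  A \subset Der s -> e * n%:R <= #|A|%:R ->
  {in A, forall v, (t <= (balanced_load R (graph_meet s K K) v)%:E)%E} ->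
  (t <= self_overlap_level e K)%E.
Proof.
move=> As Ae At; rewrite /self_overlap_level.
apply: le_trans (le_bigmax_cond _ _ (j := s) isT) => /=.
apply: le_trans (le_bigmax_cond _ _ (j := A) _) => /=; last by rewrite As.
by apply: le_bigmin => [|v vA]; [exact: leey|exact: At].
Qed.

(** The counted vertices not fixed by tau form an admissible set: there are at least n (V_frac -
    overlap) of them, and passing to the larger graph keeps their loads above [t]. *)
Lemma self_overlap_level_union (R : realType) (n : nat) (e : R)
    (G H : edge_set n) (s sstar : 'S_n) (t : \bar R) :
  e <= V_frac (graph_meet s G H) t - overlap R s sstar ->
  (t <= self_overlap_level e (graph_join sstar G H))%E.
Proof.
move=> he; pose V := V_ge (graph_meet s G H) t.
apply: (@self_overlap_level_ge _ _ _ _ (sstar^-1 * s)%g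
    (V :\: Fix (sstar^-1 * s)%g)%SET).
- by apply/fintype.subsetP => v; rewrite !inE => /andP[].
- have /ler_wpM2r : e <= (#|V|%:R - #|Fix (sstar^-1 * s)%g|%:R) / n%:R.
    by rewrite mulrBl card_Fix_overlap.
  move=> /(_ n%:R (ler0n _ _)) /le_trans; apply.
  (* For n = 0 the division cannot be cancelled, but the left side is then 0. *)
  have [n0|n0] := eqVneq (n%:R : R) 0; first by rewrite n0 mulr0 ler0n.
  rewrite divfK // lerBlDr -natrD ler_nat addnC -leq_subLR.
  by rewrite cardsD leq_sub2l // subset_leq_card // finset.subsetIr.
- move=> v; rewrite !inE => /andP[_] /le_trans; apply.
  by rewrite lee_fin balanced_load_mono // graph_meet_sub_union.
Qed.

Lemma self_overlap_level_ge0 (R : realType) (n : nat) (e : R)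
    (K : edge_set n) : (0 <= self_overlap_level e K)%E.
Proof. exact: bigmax_ge_id. Qed.

(** A higher size threshold leaves fewer admissible sets. This turns the limit at 0+ in [SOV] into a
    supremum. *)
Lemma self_overlap_level_anti (R : realType) (n : nat) (e e' : R)
    (K : edge_set n) :
  e <= e' -> (self_overlap_level e' K <= self_overlap_level e K)%E.
Proof.
move=> ee'; apply: le_bigmax2 => s _; apply: sub_bigmax => A /= /andP[-> /=].
by apply: le_trans; rewrite ler_wpM2r.
Qed.

(** * Measurability of finite-valued random elements *)

Lemma random_element_comp (d : measure_display) (T : measurableType d)
    (X Y : Type) (f : T -> X) (h : X -> Y) :
  random_element f -> random_element (fun w => h (f w)).
Proof. by move=> rf B; exact: (rf (h @^-1` B)). Qed.

(** Finiteness makes the preimage of an arbitrary set a finite union of measurable rectangles. *)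
Lemma random_element_pair (d : measure_display) (T : measurableType d)
    (X Y : finType) (f : T -> X) (g : T -> Y) :
  random_element f -> random_element g -> random_element (fun w => (f w, g w)).
Proof.
move=> rf rg B.
have -> : (fun w => (f w, g w)) @^-1` B =
    \bigcup_(p in B) (f @^-1` [set p.1] `&` g @^-1` [set p.2]).
  apply/seteqP; split=> [w Bw|w [[x y] Bxy /= [fw gw]]].
    by exists (f w, g w).
  by rewrite /= fw gw.
apply: fin_bigcup_measurable => [|p _]; first exact: finite_finset.
by apply: measurableI; [exact: rf|exact: rg].
Qed.

(** * Limits superior in probability and [SOV] *)

Lemma le_limn_esup (R : realType) (u v : nat -> \bar R) :
  (forall n, u n <= v n)%E -> (limn_esup u <= limn_esup v)%E.
Proof.
move=> uv; rewrite /limn_esup !limf_esupE.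
apply: le_ereal_inf_tmp => _ [V FV <-].
apply: ereal_inf_le; exists (ereal_sup (u @` V)); first by exists V.
apply: ge_ereal_sup => _ [n Vn <-]; apply: le_ereal_sup_tmp.
by exists (v n) => //; exists n.
Qed.

Lemma le_plimsup (R : realType) (d : nat -> measure_display)
    (T : forall n : nat, measurableType (d n))
    (P : forall n : nat, probability (T n) R)
    (X Y : forall n : nat, T n -> \bar R) :
  (forall n, random_element (X n)) -> (forall n, random_element (Y n)) ->
  (forall n w, X n w <= Y n w)%E ->
  (plimsup P X <= plimsup P Y)%E.
Proof.
move=> rX rY XY; apply: ereal_sup_le => _ [x /= lx <-]; exists x => //=.
apply: (lt_le_trans lx); apply: le_limn_esup => n.
apply: le_measure; rewrite ?inE.
- exact: (rX n [set y | x%:E <= y]%E).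
- exact: (rY n [set y | x%:E <= y]%E).
- by move=> w /= xX; exact: le_trans xX (XY n w).
Qed.

Lemma plimsup_ge0 (R : realType) (d : nat -> measure_display)
    (T : forall n : nat, measurableType (d n))
    (P : forall n : nat, probability (T n) R)
    (X : forall n : nat, T n -> \bar R) :
  (forall n w, 0 <= X n w)%E -> (0 <= plimsup P X)%E.
Proof.
move=> X0; apply: ereal_sup_ubound; exists 0 => //=.
suff -> : (fun n => P n [set w | 0%:E <= X n w]%E) = cst 1%E.
  by have [_ ->] := cvg_limn_einf_sup (cvg_cst (1%E : \bar R)); rewrite lte01.
apply/funext => n; rewrite /cst -(probability_setT (P n)); congr (P n _).
by apply/seteqP; split=> w //= _; exact: X0.
Qed.

(** If these probabilities had a positive limsup, [x] would belong to the set whose supremum is the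
    plimsup. *)
Lemma plimsup_cvg0 (R : realType) (d : nat -> measure_display)
    (T : forall n : nat, measurableType (d n))
    (P : forall n : nat, probability (T n) R)
    (X : forall n : nat, T n -> \bar R) (x : R) :
  (plimsup P X < x%:E)%E ->
  (fun n => P n [set w | x%:E <= X n w]%E) @ \oo --> 0%E.
Proof.
move=> Xx; apply: limn_esup_le_cvg => [|n]; last exact: measure_ge0.
rewrite leNgt; apply/negP => x0; move: Xx; apply/negP; rewrite -leNgt.
by apply: ereal_sup_ubound; exists x.
Qed.

(** By antitonicity in the threshold, the right limit at 0 is the supremum over all positive
    thresholds. *)
Lemma plimsup_le_SOV (R : realType) (d : nat -> measure_display)
    (T : forall n : nat, measurableType (d n))
    (P : forall n : nat, probability (T n) R)
    (K : forall n : nat, T n -> edge_set n) (e : R) :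
  (forall n, random_element (K n)) -> 0 < e ->
  (plimsup P (fun n w => self_overlap_level e (K n w)) <= SOV P K)%E.
Proof.
move=> rK e0; rewrite /SOV.
have anti : {in Interval (BRight (0 : R)) +oo%O &, forall a b, a <= b ->
   (plimsup P (fun n w => self_overlap_level b (K n w)) <=
    plimsup P (fun n w => self_overlap_level a (K n w)))%E}.
  move=> a b _ _ ab; apply: le_plimsup => n.
  - exact: (random_element_comp (self_overlap_level b)).
  - exact: (random_element_comp (self_overlap_level a)).
  - by move=> w; exact: self_overlap_level_anti.
have ltb : (BRight (0 : R) < +oo)%O by rewrite bnd_simp.
have := nonincreasing_at_right_cvge _ ltb anti.
move=> /cvg_lim -> //; apply: ereal_sup_ubound.
by exists e => //=; rewrite in_itv /= e0.
Qed.

(** * The estimator and its overlap *)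

(** The threshold [t] is deterministic, so this depends on the observation only; [1%g] merely
    witnesses that the range of the maximum is nonempty. *)
Definition maximal_matching (R : realType) (t : \bar R) (n : nat)
    (G H : edge_set n) : 'S_n :=
  [arg max_(s > 1%g) #|V_ge (graph_meet s G H) t|].

Lemma V_frac_maximal_matching (R : realType) (t : \bar R) (n : nat)
    (G H : edge_set n) (s : 'S_n) :
  V_frac (graph_meet s G H) t <=
  V_frac (graph_meet (maximal_matching t G H) G H) t :> R.
Proof.
rewrite /V_frac ler_wpM2r ?invr_ge0 // ler_nat /maximal_matching.
by case: arg_maxnP => // s' _; exact.
Qed.

Theorem theorem1 (R : realType) (d : nat -> measure_display)
    (T : forall n : nat, measurableType (d n))
    (P : forall n : nat, probability (T n) R)
    (K1 K2 : forall n : nat, T n -> edge_set n)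
    (sstar : forall n : nat, T n -> 'S_n)
    (hsys : forall n : nat,
       correlated_graph_system (P n) (K1 n) (K2 n) (sstar n))
    (rho : \bar R)
    (hrho : rho = SOV P (fun n => true_union (K1 n) (K2 n) (sstar n)))
    (eps : R) (heps : 0 < eps) :
  exists sigmahat : forall n : nat, edge_set n -> edge_set n -> 'S_n,
    asymp_ge P
      (fun n w => overlap R
         (sigmahat n (obsG (K1 n) (sstar n) w) (obsH (K2 n) w)) (sstar n w))
      (fun n w =>
         V_frac (true_intersection (K1 n) (K2 n) (sstar n) w)
           (rho + eps%:E)%E).
Proof.
pose t := (rho + eps%:E)%E.
exists (fun n => @maximal_matching R t n).
set X := fun (n : nat) (w : T n) => overlap R _ _.
set Y := fun (n : nat) (w : T n) => V_frac _ _.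
(* All variables below are functions of this finite-valued triple, hence measurable. *)
pose Q n w := (K1 n w, K2 n w, sstar n w).
have rQ n : random_element (Q n).
  have [[r1 r2] _ rs _ _] := hsys n.
  by do 2 apply: random_element_pair => //.
have X0 n w : 0 <= X n w by rewrite divr_ge0.
have Y0 n w : 0 <= Y n w by rewrite divr_ge0.
(* The least nonnegative factor with Y (1 - c) <= X. *)
pose c n w : R := if Y n w == 0 then 0 else Num.max 0 (1 - X n w / Y n w).
have rU n : random_element (true_union (K1 n) (K2 n) (sstar n)).
  exact: (random_element_comp (fun q => graph_join q.2
    (perm_graph (q.2)^-1%g q.1.1) q.1.2) (rQ n)).
have rXY n : random_element (fun w => (X n w, Y n w)).
  exact: (random_element_comp (fun q =>
    let G := perm_graph (q.2)^-1%g q.1.1 in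
    (overlap R (maximal_matching t G q.1.2) q.2,
     V_frac (graph_meet q.2 G q.1.2) t)) (rQ n)).
pose cf (p : R * R) : R := if p.2 == 0 then 0 else Num.max 0 (1 - p.1 / p.2).
(* The true matching competes in the maximum, so [Y] is at most the fraction attained by the
   estimator. *)
have XY_level n w (e : R) : e <= Y n w - X n w ->
    (t <= self_overlap_level e (true_union (K1 n) (K2 n) (sstar n) w))%E.
  move=> he; apply: (@self_overlap_level_union _ _ _ _ _
    (maximal_matching t (obsG (K1 n) (sstar n) w) (obsH (K2 n) w))).
  by apply: le_trans he (lerB _ (lexx _)); exact: V_frac_maximal_matching.
exists c; split.
- move=> n _ B _; rewrite setTI.
  exact: (random_element_comp cf (rXY n)).
- move=> n w; rewrite /c; case: eqVneq => [->|Yn0]; first by rewrite mul0r.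
  have Ypos : 0 < Y n w by rewrite lt_def Yn0 Y0.
  have : 1 - X n w / Y n w <= Num.max 0 (1 - X n w / Y n w).
    by rewrite le_max lexx orbT.
  rewrite lerBlDr -lerBlDl ler_pdivlMr // => h.
  by rewrite mulrC.
move=> delta delta0 eta eta0.
pose E n := [set w | eta <= `|if delta <= Y n w then c n w else 0|].
rewrite -[X in X @ _]/(fun n => P n (E n)).
(* On this event Y >= delta and 1 - X / Y >= eta, so Y - X >= eta Y >= eta delta. *)
have EXY n w : E n w -> eta * delta <= Y n w - X n w.
  rewrite /E /=; case: ifPn => [dY|_]; last by rewrite normr0 leNgt eta0.
  have Ypos : 0 < Y n w by exact: lt_le_trans dY.
  rewrite /c gt_eqF // ger0_norm ?le_max ?lexx //.
  rewrite leNgt eta0 /= lerBrDr -lerBrDl ler_pdivrMr // => h.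
  have := ler_wpM2l (ltW eta0) dY; rewrite -/(Y n w) in h *; lra.
have ed0 : 0 < eta * delta by rewrite mulr_gt0.
(* This excludes -oo, leaving [rho] either +oo or real. *)
have rho0 : (0 <= rho)%E.
  rewrite hrho; apply: le_trans (plimsup_le_SOV P rU ed0).
  by apply: plimsup_ge0 => n w; exact: self_overlap_level_ge0.
have mE n : measurable (E n).
  exact: (rXY n [set p | eta <= `|if delta <= p.2 then cf p else 0|]).
(* No finite load reaches an infinite threshold, so Y = 0 and the bad event is empty. *)
have [rhoy|rhoNy] := eqVneq rho +oo%E.
  suff E0 n : E n = set0.
    rewrite (_ : (fun n => P n (E n)) = cst 0%E); first exact: cvg_cst.
    by apply/funext => n; rewrite E0 measure0.
  apply/seteqP; split=> // w /EXY; apply/negP; rewrite -ltNge.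
  suff -> : Y n w = 0 by rewrite sub0r (le_lt_trans _ ed0) // oppr_le0.
  rewrite /Y /V_frac /V_ge rhoy /=.
  by rewrite (_ : [set v | _]%SET = finset.set0) ?cards0 ?mul0r.
pose r := fine rho.
have rhoE : rho = r%:E.
  by rewrite fineK // ge0_fin_numE // ltey.
have tE : t = (r + eps)%:E by rewrite /t rhoE.
(* The bad event forces the self-overlap level at the fixed threshold [eta * delta] up to r + eps,
   strictly above its plimsup, which is at most [rho]. *)
apply: (@squeeze_cvge _ _ _ _ (cst 0%E) _ (fun n => P n [set w |
     ((r + eps)%:E <= self_overlap_level (eta * delta)
       (true_union (K1 n) (K2 n) (sstar n) w))%E])).
- apply: nearW => n; rewrite measure_ge0 /= le_measure ?inE //.
    exact: (random_element_comp (self_overlap_level (eta * delta))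
         (rU n) [set y | (r + eps)%:E <= y]%E).
  by move=> w /EXY /XY_level; rewrite tE.
- exact: cvg_cst.
- apply: plimsup_cvg0; apply: le_lt_trans (plimsup_le_SOV P rU ed0) _.
  by rewrite -hrho rhoE lte_fin ltrDl.
Qed.
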